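(* Let $\mathbb{K}$ be a field of characteristic $0$ and let $G\subset G(m,n,p)$ be a Lie group. For $A\in Mat(m,n,p)$ and $j\ge0$ let $$V^{(j)}(A)=\{\pi_j(\nu A)\ |\ \nu\in\mathcal{L}ie(G),\ \pi_{j-1}(\nu A)=0\}\subset Mat^{(j)}(m,n,p)$$ (one has $V^{(j)}(A)=V^{(j)}(\pi_{j-1}A)$), and let $W^{(j)}(A)$ be a complementary subspace, i.e. $V^{(j)}(A)\oplus W^{(j)}(A)=Mat^{(j)}(m,n,p)$. Define $$N(G)=\{B\in Mat(m,n,p):\ B^{(j)}\in W^{(j)}(B),\ j=0,1,\dots\}.$$ Then: 1. The set $N(G)$ is a normal form with respect to the action of $G$ on $Mat(m,n,p)$. 2. The set $N(G)$ is a canonical form with respect to the action of $G^0$.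
   Context: $m,n,p\ge1$ are integers. $Mat(m,n,p)$ is the space of $m\times n$ matrices with entries in $\mathbb{K}[[x_1,\dots,x_p]]$, written $A=\sum_IA_Ix^I$. Put $\pi_jA=\sum_{|I|\le j}A_Ix^I$, $\pi_{-1}=0$, $A^{(j)}=\sum_{|I|=j}A_Ix^I$ (componentwise on pairs); $Mat^{(j)}(m,n,p)$ is the space of homogeneous matrices of degree $j$. A sequence $A_k$ converges to $A$ if for every $j$ one has $\pi_jA_k=\pi_jA$ for all large $k$ (similarly for pairs); a set is closed if it contains the limits of its convergent sequences. The group $G(m,n,p)=GL(m,\mathbb{K}[[x_1,\dots,x_p]])\times GL(n,\mathbb{K}[[x_1,\dots,x_p]])$ acts on $Mat(m,n,p)$ by $(U,V).A=UAV^{-1}$. For a subgroup $G$, $G^0=\{(U,V)\in G:\pi_0U=1,\ \pi_0V=1\}$, where $1$ denotes the identity matrix. For $\lambda=(\lambda_l,\lambda_r)\in Mat(m,m,p)\times Mat(n,n,p)$ with $\pi_0\lambda_l=0$, $\pi_0\lambda_r=0$, put $\exp\lambda=(\exp\lambda_l,\exp\lambda_r)$, where $\exp$ is the usual exponential series. Every element of $G(m,n,p)^0$ is such an exponential. A closed subgroup $G\subset G(m,n,p)$ is called a Lie group if for every $g=\exp\lambda\in G^0$ the one-parametric group $\{\exp(t\lambda):t\in\mathbb{K}\}$ is contained in $G$. Its Lie algebra $\mathcal{L}ie(G)$ is the set of all such $\lambda$ with $\exp(t\lambda)\in G$ for all $t\in\mathbb{K}$. For $\nu=(\nu_l,\nu_r)$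 write $\nu A=\nu_lA-A\nu_r$. A subset $N$ is a normal form with respect to an action if it intersects every orbit, and a canonical (normal) form if it intersects every orbit in exactly one point.
   Formalization: The complement W^(j)(A) is required to depend on A only through π_{j-1}A (as V^(j)(A) does); if W^(j)(A) may depend on all of A, the claim fails, e.g. for the orbit of x_1+x_2^2 with m=n=1, p=2. *)

(* Defs.v *)
From HB Require Import structures.
From mathcomp Require Import all_boot all_order all_algebra.
From mathcomp Require Import boolp classical_sets.
From mathcomp Require Import mpoly.

Set Implicit Arguments.
Unset Strict Implicit.
Unset Printing Implicit Defensive.

Import GRing.Theory.
Local Open Scope ring_scope.
Local Open Scope classical_set_scope.

(* The series \sum_I f_I x^I is the family of its coefficients, indexed by the
   multi-indices I : 'X_{1..p} of [mpoly]; the total degree |I| is [mdeg I]. *)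
Record fps (p : nat) (K : Type) := FPS { fpscoef :> 'X_{1..p} -> K }.

Lemma fpsP (p : nat) (K : Type) (f g : fps p K) :
  (forall I, f I = g I) -> f = g.
Proof. by case: f => f; case: g => g /= fg; congr FPS; apply: funext. Qed.

HB.instance Definition _ (p : nat) (K : Type) := gen_eqMixin (fps p K).
HB.instance Definition _ (p : nat) (K : Type) := gen_choiceMixin (fps p K).

(* The bounds on the two multi-indices only make the index type finite: they
   are implied by I = J1 + J2. *)
HB.lock Definition fps_mul (p : nat) (K : comNzRingType) (f g : fps p K) :
    fps p K :=
  FPS (fun I => \sum_(J : 'X_{1..p < (mdeg I).+1, (mdeg I).+1}
                     | I == (J.1 + J.2)%MM) f J.1 * g J.2).

Arguments fps_mul {p K} f g.

Section FpsRing.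
Variables (p : nat) (K : comNzRingType).
Implicit Types (f g h : fps p K) (I J : 'X_{1..p}).

Definition fpsC (c : K) : fps p K := FPS (fun I => if I == 0%MM then c else 0).
Definition fps_add f g : fps p K := FPS (fun I => f I + g I).
Definition fps_opp f : fps p K := FPS (fun I => - f I).

Lemma fps_addA : associative fps_add.
Proof. by move=> f g h; apply: fpsP => I /=; rewrite addrA. Qed.
Lemma fps_addC : commutative fps_add.
Proof. by move=> f g; apply: fpsP => I /=; rewrite addrC. Qed.
Lemma fps_add0 : left_id (fpsC 0) fps_add.
Proof. by move=> f; apply: fpsP => I /=; rewrite if_same add0r. Qed.
Lemma fps_addN : left_inverse (fpsC 0) fps_opp fps_add.
Proof. by move=> f; apply: fpsP => I /=; rewrite if_same addNr. Qed.

HB.instance Definition _ := GRing.isZmodule.Build (fps p K)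
  fps_addA fps_addC fps_add0 fps_addN.

Definition fps_mpoly (d : nat) f : {mpoly K[p]} :=
  \sum_(J : 'X_{1..p < d}) f J *: 'X_[J].

Lemma mcoeff_fps_mpoly d f I : (mdeg I < d)%N -> (fps_mpoly d f)@_I = f I.
Proof. exact: mcoeff_mpoly. Qed.

Lemma mcoeffM_eq (P1 P2 Q1 Q2 : {mpoly K[p]}) I :
    (forall J, (mdeg J <= mdeg I)%N -> P1@_J = P2@_J) ->
    (forall J, (mdeg J <= mdeg I)%N -> Q1@_J = Q2@_J) ->
  (P1 * Q1)@_I = (P2 * Q2)@_I.
Proof.
move=> eP eQ; rewrite !mcoeffM; apply: eq_bigr => J _.
by rewrite eP ?eQ // -ltnS bmdeg.
Qed.

Lemma fps_mulE d f g I : (mdeg I < d)%N ->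
  fps_mul f g I = (fps_mpoly d f * fps_mpoly d g)@_I.
Proof.
move=> Id; rewrite fps_mul.unlock mcoeffM; apply: eq_bigr => J _.
by rewrite !mcoeff_fps_mpoly //; apply: leq_ltn_trans Id; rewrite -ltnS bmdeg.
Qed.

Lemma mcoeff_fps_mpolyM d f g I : (mdeg I < d)%N ->
  (fps_mpoly d (fps_mul f g))@_I = (fps_mpoly d f * fps_mpoly d g)@_I.
Proof. by move=> Id; rewrite mcoeff_fps_mpoly // (fps_mulE _ _ Id). Qed.

Lemma fps_mulA : associative (@fps_mul p K).
Proof.
move=> f g h; apply: fpsP => I; have ltI := ltnSn (mdeg I).
rewrite !(fps_mulE _ _ ltI).
transitivity ((fps_mpoly (mdeg I).+1 f *
   (fps_mpoly (mdeg I).+1 g * fps_mpoly (mdeg I).+1 h))@_I).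
  by apply: mcoeffM_eq => // J leJ; rewrite mcoeff_fps_mpolyM // ltnS.
rewrite mulrA.
by apply: mcoeffM_eq => // J leJ; rewrite mcoeff_fps_mpolyM // ltnS.
Qed.

Lemma fps_mulC : commutative (@fps_mul p K).
Proof.
move=> f g; apply: fpsP => I; have ltI := ltnSn (mdeg I).
by rewrite !(fps_mulE _ _ ltI) mulrC.
Qed.

Lemma fps_mul1 : left_id (fpsC 1) (@fps_mul p K).
Proof.
move=> f; apply: fpsP => I; have ltI := ltnSn (mdeg I).
rewrite (fps_mulE _ _ ltI) -[RHS](mcoeff_fps_mpoly f ltI) -[in RHS](mul1r (fps_mpoly _ f)).
apply: mcoeffM_eq => // J leJ; rewrite mcoeff_fps_mpoly ?ltnS //= mcoeff1.
by case: eqP.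
Qed.

Lemma fps_mulDl : left_distributive (@fps_mul p K) fps_add.
Proof.
move=> f g h; apply: fpsP => I; rewrite !fps_mul.unlock /=.
by rewrite -big_split; apply: eq_bigr => J _; rewrite mulrDl.
Qed.

Lemma fps_oner_neq0 : fpsC 1 != 0.
Proof.
apply/eqP => /(congr1 (fun f => fpscoef f 0%MM)) /= /eqP.
by rewrite !eqxx oner_eq0.
Qed.

HB.instance Definition _ := GRing.Zmodule_isComNzRing.Build (fps p K)
  fps_mulA fps_mulC fps_mul1 fps_mulDl fps_oner_neq0.

Definition fps_unit : pred (fps p K) := fun f => `[< exists g, g * f = 1 >].
Definition fps_inv f : fps p K := xget f [set g | g * f = 1].

Lemma fps_mulV : {in fps_unit, left_inverse 1 fps_inv *%R}.
Proof. by move=> f /asboolP fU; exact: (xgetPex f fU). Qed.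
Lemma fps_unitP f g : g * f = 1 -> fps_unit f.
Proof. by move=> gf; apply/asboolP; exists g. Qed.
Lemma fps_inv_out : {in [predC fps_unit], fps_inv =1 id}.
Proof.
move=> f; rewrite inE => /asboolP fNU.
by apply: xgetPN => g /= gf; apply: fNU; exists g.
Qed.

HB.instance Definition _ := GRing.ComNzRing_hasMulInverse.Build (fps p K)
  fps_mulV fps_unitP fps_inv_out.

End FpsRing.

(* [jet k A] is the sum of the A_I x^I with |I| < k: the bound is strict, so
   that pi_j A is [jet j.+1 A], and pi_(j-1) A is [jet j A], also for j = 0. *)
HB.lock Definition jet (p : nat) (K : fieldType) (k m n : nat)
    (A : 'M[fps p K]_(m, n)) : 'M[fps p K]_(m, n) :=
  map_mx (fun f : fps p K => FPS (fun I => if (mdeg I < k)%N then f I else 0)) A.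
Arguments jet {p K} k {m n} A.

HB.lock Definition hpart (p : nat) (K : fieldType) (j m n : nat)
    (A : 'M[fps p K]_(m, n)) : 'M[fps p K]_(m, n) :=
  map_mx (fun f : fps p K => FPS (fun I => if mdeg I == j then f I else 0)) A.
Arguments hpart {p K} j {m n} A.

Section Matrices.
Variables (p : nat) (K : fieldType).

Definition homogeneous (j m n : nat) : set 'M[fps p K]_(m, n) :=
  [set A : 'M[fps p K]_(m, n) | forall i k I, mdeg I != j -> A i k I = 0].

Definition mxcvg (m n : nat) (u : nat -> 'M[fps p K]_(m, n))
    (A : 'M[fps p K]_(m, n)) : Prop :=
  forall j, exists k0, forall k, (k0 <= k)%N -> jet j.+1 (u k) = jet j.+1 A.

(* If lambda has no constant term then lambda ^+ k starts in degree k, so that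
   the terms with k <= |I| of the exponential series give the exact coefficient
   of x^I: see [mxexp_cvg].  For other lambda the value is meaningless. *)
Definition mxexp (n : nat) (lambda : 'M[fps p K]_n) : 'M[fps p K]_n :=
  \matrix_(i, j) FPS (fun I =>
    (\sum_(k < (mdeg I).+1) fpsC p (k`!%:R^-1) *: lambda ^+ k) i j I).

Lemma jetE (k m n : nat) (A : 'M[fps p K]_(m, n)) i j I :
  jet k A i j I = if (mdeg I < k)%N then A i j I else 0.
Proof. by rewrite jet.unlock mxE. Qed.

Lemma hpartE (j m n : nat) (A : 'M[fps p K]_(m, n)) i k I :
  hpart j A i k I = if mdeg I == j then A i k I else 0.
Proof. by rewrite hpart.unlock mxE. Qed.

Lemma fps_sum (T : Type) (r : seq T) (P : pred T) (F : T -> fps p K) I :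
  (\sum_(t <- r | P t) F t) I = \sum_(t <- r | P t) F t I.
Proof.
elim/big_rec2: _ => [|t y1 y2 _ <- //] /=.
by rewrite if_same.
Qed.

Lemma fpsM_small (f g : fps p K) (a b : nat) I :
    (forall J, (mdeg J < a)%N -> f J = 0) ->
    (forall J, (mdeg J < b)%N -> g J = 0) ->
  (mdeg I < a + b)%N -> (f * g) I = 0.
Proof.
move=> fa gb Iab; rewrite -[f * g]/(fps_mul f g) fps_mul.unlock; apply: big1 => J /eqP eI.
have [Ja|aJ] := ltnP (mdeg (J.1 : 'X_{1..p})) a; first by rewrite fa ?mul0r.
rewrite gb ?mulr0 // -(ltn_add2l a); apply: leq_ltn_trans Iab.
by rewrite [X in (_ <= X)%N](congr1 mdeg eI) mdegD leq_add2r.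
Qed.

Lemma fpsB (f g : fps p K) I : (f - g) I = f I - g I.
Proof. by []. Qed.

Lemma jet_eq0 (k m n : nat) (A : 'M[fps p K]_(m, n)) i j I :
  jet k A = 0 -> (mdeg I < k)%N -> A i j I = 0.
Proof.
move=> A0 Ik.
have := congr1 (fun M : 'M[fps p K]_(m, n) => M i j I) A0.
by rewrite jetE Ik mxE /= if_same.
Qed.

Lemma mxX_small (n : nat) (lambda : 'M[fps p K]_n) (k : nat) i j I :
  jet 1 lambda = 0 -> (mdeg I < k)%N -> (lambda ^+ k) i j I = 0.
Proof.
move=> l0; elim: k i j I => // k IHk i j I Ik.
rewrite exprSr mxE fps_sum; apply: big1 => s _.
apply: (@fpsM_small _ _ k 1) => [J Jk|J J1|]; rewrite ?addn1 ?IHk //.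
exact: jet_eq0 l0 J1.
Qed.

Lemma mxexp_cvg (n : nat) (lambda : 'M[fps p K]_n) : jet 1 lambda = 0 ->
  mxcvg (fun N => \sum_(k < N) fpsC p (k`!%:R^-1) *: lambda ^+ k)
        (mxexp lambda).
Proof.
move=> l0 d; exists d.+1 => N dN; apply/matrixP => i j; apply: fpsP => I.
rewrite !jetE; case: ifP => // Id; rewrite [in RHS]mxE /=.
pose F k := (fpsC p (k`!%:R^-1 : K) *: lambda ^+ k) i j I.
rewrite !summxE !fps_sum; apply/esym.
transitivity (\sum_(k < N | (k < (mdeg I).+1)%N) F k).
  by rewrite -(big_ord_widen N F) //; exact: leq_trans Id dN.
rewrite big_mkcond; apply: eq_bigr => k _; case: ifP => // /negbT.
rewrite -leqNgt => Ik; rewrite mxE; apply/esym.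
by apply: (@fpsM_small _ _ 0 k) => // J Jk; apply: mxX_small.
Qed.

End Matrices.

Arguments homogeneous : clear implicits.

Section LieGroups.
Variables (K : fieldType) (m n p : nat).

Local Notation Mat := 'M[fps p K]_(m, n).
Local Notation pair := ('M[fps p K]_m * 'M[fps p K]_n)%type.

Definition pair_GL : set pair := [set g | g.1 \in unitmx /\ g.2 \in unitmx].

Definition pair_one : pair := (1%:M, 1%:M).
Definition pair_mul (g h : pair) : pair := (g.1 *m h.1, g.2 *m h.2).
Definition pair_inv (g : pair) : pair := (invmx g.1, invmx g.2).
Definition pair_jet (k : nat) (g : pair) : pair := (jet k g.1, jet k g.2).
Definition pair_scale (t : K) (g : pair) : pair :=
  (fpsC p t *: g.1, fpsC p t *: g.2).
Definition pair_exp (lambda : pair) : pair :=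
  (mxexp lambda.1, mxexp lambda.2).

Definition pair_cvg (u : nat -> pair) (g : pair) : Prop :=
  forall j, exists k0, forall k, (k0 <= k)%N ->
    pair_jet j.+1 (u k) = pair_jet j.+1 g.

Definition pair_closed (S : set pair) : Prop :=
  forall (u : nat -> pair) g, (forall k, S (u k)) -> pair_cvg u g -> S g.

Definition is_subgroup (G : set pair) : Prop :=
  [/\ G `<=` pair_GL,
      G pair_one,
      forall g h, G g -> G h -> G (pair_mul g h)
    & forall g, G g -> G (pair_inv g)].

(* G^0 *)
Definition unipotent_part (G : set pair) : set pair :=
  [set g | G g /\ pair_jet 1 g = pair_one].

Definition is_Lie_group (G : set pair) : Prop :=
  [/\ is_subgroup G,
      pair_closed G
    & forall lambda : pair, pair_jet 1 lambda = (0, 0) ->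
        unipotent_part G (pair_exp lambda) ->
        forall t : K, G (pair_exp (pair_scale t lambda))].

Definition Lie (G : set pair) : set pair :=
  [set lambda | pair_jet 1 lambda = (0, 0) /\
     forall t : K, G (pair_exp (pair_scale t lambda))].

Definition act (g : pair) (A : Mat) : Mat := g.1 *m A *m invmx g.2.

Definition inf_act (nu : pair) (A : Mat) : Mat := nu.1 *m A - A *m nu.2.

(* V^(j)(A) *)
Definition tangent (G : set pair) (j : nat) (A : Mat) : set Mat :=
  [set jet j.+1 (inf_act nu A) |
     nu in [set nu | Lie G nu /\ jet j (inf_act nu A) = 0]].

Lemma inf_act_jet (nu : pair) (j : nat) (A : Mat) :
  pair_jet 1 nu = (0, 0) ->
  jet j.+1 (inf_act nu A) = jet j.+1 (inf_act nu (jet j A)).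
Proof.
case: nu => nu1 nu2 [nu1_0 nu2_0].
have small1 i k J : (mdeg J < 1)%N -> nu1 i k J = 0.
  exact: jet_eq0 nu1_0.
have small2 i k J : (mdeg J < 1)%N -> nu2 i k J = 0.
  exact: jet_eq0 nu2_0.
have diff0 i k J : (mdeg J < j)%N -> (A i k - jet j A i k) J = 0.
  by move=> Jj; rewrite fpsB jetE Jj subrr.
apply/matrixP => i k; apply: fpsP => I; rewrite 2!jetE; case: ifP => Ij; last by [].
have prod1 s : (nu1 i s * A s k) I = (nu1 i s * jet j A s k) I.
  apply/eqP; rewrite -subr_eq0 -fpsB -mulrBr; apply/eqP.
  exact: (@fpsM_small _ _ _ _ 1 j _ (small1 i s) (diff0 s k)).
have prod2 s : (A i s * nu2 s k) I = (jet j A i s * nu2 s k) I.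
  apply/eqP; rewrite -subr_eq0 -fpsB -mulrBl; apply/eqP.
  by apply: (@fpsM_small _ _ _ _ j 1 _ (diff0 i s) (small2 s k)); rewrite addn1.
have entry (B : Mat) : inf_act (nu1, nu2) B i k I =
    \sum_s (nu1 i s * B s k) I - \sum_s (B i s * nu2 s k) I.
  by rewrite /inf_act mxE [in LHS]mxE mxE mxE fpsB !fps_sum.
by rewrite !entry (eq_bigr _ (fun s _ => prod1 s)) (eq_bigr _ (fun s _ => prod2 s)).
Qed.

Lemma jet_jetS (j : nat) (A B : Mat) :
  jet j.+1 A = jet j.+1 B -> jet j A = jet j B.
Proof.
move=> AB; apply/matrixP => i k; apply: fpsP => I.
have := congr1 (fun M : Mat => M i k I) AB; rewrite !jetE.
by case: (ltnP (mdeg I) j) => // ltI; rewrite ltnS ltnW.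
Qed.

Lemma tangent_jet (G : set pair) (j : nat) (A : Mat) :
  tangent G j A = tangent G j (jet j A).
Proof.
apply/seteqP; split=> _ [nu [Lnu nuA] <-];
  have eA := inf_act_jet j A Lnu.1; exists nu.
- by split; [exact: Lnu | rewrite -nuA; apply: jet_jetS; exact: esym eA].
- exact: esym eA.
- by split; [exact: Lnu | rewrite -nuA; apply: jet_jetS; exact: eA].
- exact: eA.
Qed.

Definition is_subspace (S : set Mat) : Prop :=
  [/\ S 0, forall A B, S A -> S B -> S (A + B)
    & forall (c : K) A, S A -> S (fpsC p c *: A)].

(* H is the direct sum of V and W.  That V is itself a subspace is not part of
   the definition: for V = [tangent G j A], G a Lie group, it is a consequence. *)
Definition is_complement (H V W : set Mat) : Prop :=
  [/\ is_subspace W,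
      [set A + B | A in V & B in W] = H
    & V `&` W = [set 0]].

(* N(G), for the choice W of the complementary subspaces *)
Definition normal_set (W : nat -> Mat -> set Mat) : set Mat :=
  [set B | forall j, W j B (hpart j B)].

Definition orbit (G : set pair) (A : Mat) : set Mat :=
  [set act g A | g in G].

Definition is_normal_form (G : set pair) (N : set Mat) : Prop :=
  forall A, exists B, orbit G A B /\ N B.

Definition is_canonical_form (G : set pair) (N : set Mat) : Prop :=
  forall A, exists! B, orbit G A B /\ N B.

End LieGroups.

(* Main.v *)
Require Import Defs.
From mathcomp Require Import all_boot all_order all_algebra.
From mathcomp Require Import boolp classical_sets.
From mathcomp Require Import mpoly.

(** The second claim contains the first, since [unipotent_part G] lies in [G],
    so everything happens inside [G^0].

    The whole argument rests on one congruence, [mxexp_intertwine]: if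
    [X] and [Y] have no constant term and [E = X A - A Y] starts in degree [j],
    then [exp X A = A exp Y + E] up to terms of degree above [j].  For a pair
    [l] of matrices without constant term it says that [exp l] moves [A]
    exactly by [inf_act l A] in the lowest degree where anything moves
    ([act_exp_linear]); consequently [exp l] fixes [A] below degree [j] if and
    only if [inf_act l A] vanishes below degree [j] ([vanish_mxexp] is the hard
    direction), and then so does [exp (t l)] for every scalar [t].

    Existence.  Suppose that [B] satisfies the normal form condition in
    degrees below [j], and split its part of degree [j] into a tangent
    component [nu B] and a component in [W j B].  Acting by [exp (- nu)] kills
    the tangent component and leaves the lower degrees alone, and [W j] only
    sees those degrees ([normalize_step]).  Iterating gives a convergent
    sequence in the orbit of [A], whose limit is in normal form.  The group
    elements used need not converge, as each of them may contain large pieces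
    that nearly stabilize the current matrix, so one needs that orbits of
    [G^0] are closed ([orbit_closed]).

    Closed orbits.  The elements of [G^0] that carry [A] to [B] below degree
    [j] form a decreasing sequence of sets, and we look for a common element,
    degree by degree.  Fix the terms of degree below [k].  The possible terms
    of degree [k] then form an affine subspace of a finite dimensional space:
    a quotient of two solutions is [exp l] with [l] annihilating [A] below
    degree [j], and all of the line [exp (t l)] may be used
    ([transporter_affine]).  A decreasing sequence of nonempty affine subspaces
    of a finite dimensional space has a common point ([affine_compactness]),
    which fixes the terms of degree [k].

    Uniqueness.  Let [B] and [g B] be in normal form, and suppose that they
    agree below degree [j].  Writing [g = exp l], the difference of their parts
    of degree [j] is the tangent vector [inf_act l B], and it belongs to
    [W j B] as both parts do.  Hence it is zero, and [B] and [g B] agree in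
    degree [j] too ([normal_form_unique]). *)

Set Implicit Arguments.
Unset Strict Implicit.
Unset Printing Implicit Defensive.

Import GRing.Theory.
Local Open Scope ring_scope.
Local Open Scope classical_set_scope.

(** * Matrices of power series modulo high degree *)

Section Vanishing.
Variables (K : fieldType) (p : nat).

(** Equality of jets is handled as vanishing of the difference, which unlike
    the jets themselves behaves well under products. *)
Definition vanish d (a b : nat) (A : 'M[fps p K]_(a, b)) : Prop :=
  forall i k I, (mdeg I < d)%N -> A i k I = 0.

Lemma fps0E I : (0 : fps p K) I = 0.
Proof. by rewrite /= if_same. Qed.

Lemma fpsCM (c : K) (f : fps p K) I : (fpsC p c * f) I = c * f I.
Proof.
rewrite -[fpsC p c * f]/(fps_mul _ f) (fps_mulE _ _ (ltnSn (mdeg I))).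
rewrite -[f I in RHS](mcoeff_fps_mpoly f (ltnSn (mdeg I))) -mcoeffCM.
apply: mcoeffM_eq => // J leJ; rewrite mcoeff_fps_mpoly ?ltnS //= mcoeffC.
by rewrite eq_sym; case: eqP; rewrite ?mulr1 ?mulr0.
Qed.

Lemma fpsCN1 : fpsC p (-1 : K) = -1.
Proof. by apply: fpsP => I /=; case: (I == 0%MM); rewrite ?oppr0. Qed.

Lemma vanish_le d e (a b : nat) (A : 'M[fps p K]_(a, b)) :
  (e <= d)%N -> vanish d A -> vanish e A.
Proof. by move=> ed vA i k I Ie; apply: vA; apply: leq_trans ed. Qed.

Lemma vanish00 d (a b : nat) : vanish d (0 : 'M[fps p K]_(a, b)).
Proof. by move=> i k I _; rewrite mxE fps0E. Qed.

Lemma vanishD d (a b : nat) (A B : 'M[fps p K]_(a, b)) :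
  vanish d A -> vanish d B -> vanish d (A + B).
Proof. by move=> vA vB i k I Id; rewrite mxE /= vA ?vB ?addr0. Qed.

Lemma vanishN d (a b : nat) (A : 'M[fps p K]_(a, b)) :
  vanish d A -> vanish d (- A).
Proof. by move=> vA i k I Id; rewrite mxE /= vA ?oppr0. Qed.

Lemma vanish_trans d (a b : nat) (A B C : 'M[fps p K]_(a, b)) :
  vanish d (A - B) -> vanish d (B - C) -> vanish d (A - C).
Proof. by move=> vA vB; rewrite -(subrKA B A (- C)); apply: vanishD. Qed.

Lemma vanish_sym d (a b : nat) (A B : 'M[fps p K]_(a, b)) :
  vanish d (A - B) -> vanish d (B - A).
Proof. by move=> vA; rewrite -opprB; apply: vanishN. Qed.

Lemma vanish_congr d (a b : nat) (A B : 'M[fps p K]_(a, b)) :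
  vanish d (A - B) -> vanish d B -> vanish d A.
Proof. by move=> vAB vB; rewrite -(subrK B A); apply: vanishD. Qed.

Lemma vanish_addl d (a b : nat) (A B C : 'M[fps p K]_(a, b)) :
  vanish d (A - (B + C)) -> vanish d (A - B - C).
Proof. by rewrite opprD addrA. Qed.

Lemma vanish_sum d (a b : nat) (T : Type) (r : seq T) (P : pred T)
    (F : T -> 'M[fps p K]_(a, b)) :
  (forall t, P t -> vanish d (F t)) -> vanish d (\sum_(t <- r | P t) F t).
Proof.
move=> vF; elim/big_rec: _ => [|t A Pt vA]; first exact: vanish00.
by apply: vanishD => //; apply: vF.
Qed.

Lemma vanishM d e (a b c : nat) (A : 'M[fps p K]_(a, b))
    (B : 'M[fps p K]_(b, c)) :
  vanish d A -> vanish e B -> vanish (d + e) (A *m B).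
Proof.
move=> vA vB i k I Id; rewrite mxE fps_sum; apply: big1 => s _.
by apply: (fpsM_small _ _ Id) => J JJ; [apply: vA | apply: vB].
Qed.

Lemma vanish_deg0 (a b : nat) (A : 'M[fps p K]_(a, b)) : vanish 0 A.
Proof. by []. Qed.

Lemma vanishMl d (a b c : nat) (A : 'M[fps p K]_(a, b))
    (B : 'M[fps p K]_(b, c)) :
  vanish d B -> vanish d (A *m B).
Proof. exact: (vanishM (@vanish_deg0 _ _ A)). Qed.

Lemma vanishMr d (a b c : nat) (A : 'M[fps p K]_(a, b))
    (B : 'M[fps p K]_(b, c)) :
  vanish d A -> vanish d (A *m B).
Proof. by move=> vA; rewrite -(addn0 d); apply: vanishM. Qed.

Lemma vanishZ d (a b : nat) (c : K) (A : 'M[fps p K]_(a, b)) :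
  vanish d A -> vanish d (fpsC p c *: A).
Proof. by move=> vA i k I Id; rewrite mxE fpsCM vA ?mulr0. Qed.

Lemma vanish_eq0 (a b : nat) (A : 'M[fps p K]_(a, b)) :
  (forall d, vanish d A) -> A = 0.
Proof.
move=> vA; apply/matrixP => i k; apply: fpsP => I.
by rewrite (vA (mdeg I).+1) // mxE fps0E.
Qed.

Lemma jet_vanish d (a b : nat) (A B : 'M[fps p K]_(a, b)) :
  jet d A = jet d B <-> vanish d (A - B).
Proof.
split=> [AB i k I Id | vAB].
  have := congr1 (fun M : 'M[fps p K]_(a, b) => M i k I) AB.
  by rewrite !jetE Id !mxE /= => ->; rewrite subrr.
apply/matrixP => i k; apply: fpsP => I; rewrite !jetE; case: ifP => // Id.
by apply/eqP; rewrite -subr_eq0 -(vAB i k I Id) !mxE.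
Qed.

Lemma jet0 d (a b : nat) : jet d (0 : 'M[fps p K]_(a, b)) = 0.
Proof.
by apply/matrixP => i k; apply: fpsP => I; rewrite jetE !mxE fps0E if_same.
Qed.

Lemma jet_vanish0 d (a b : nat) (A : 'M[fps p K]_(a, b)) :
  jet d A = 0 <-> vanish d A.
Proof. by rewrite -{1}(jet0 d) jet_vanish subr0. Qed.

(** The coefficient at [I] is stationary from the index [mdeg I + 1] on. *)
Lemma limit_exists (a b : nat) (u : nat -> 'M[fps p K]_(a, b)) :
    (forall k, vanish k (u k.+1 - u k)) ->
  exists L, forall k, vanish k (u k - L).
Proof.
move=> uC; exists (\matrix_(i, j) FPS (fun I => u (mdeg I).+1 i j I)).
move=> k i j I Ik; rewrite !mxE /=.
suff : vanish (mdeg I).+1 (u k - u (mdeg I).+1).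
  by move=> /(_ i j I (ltnSn _)); rewrite !mxE.
rewrite -(subnKC Ik); elim: (k - _)%N => [|e IHe].
  by rewrite addn0 subrr; apply: vanish00.
rewrite addnS; apply: vanish_trans IHe; apply: vanish_le (uC _).
exact: leq_addr.
Qed.

Lemma unipotent_mull k (a b : nat) (g : 'M[fps p K]_a)
    (A : 'M[fps p K]_(a, b)) :
  vanish 1 (g - 1%:M) -> vanish k A -> vanish k.+1 (g *m A - A).
Proof.
move=> vg vA; rewrite -{2}(mul1mx A) -mulmxBl -add1n; exact: vanishM.
Qed.

Lemma unipotent_mulr k (a b : nat) (g : 'M[fps p K]_b)
    (A : 'M[fps p K]_(a, b)) :
  vanish 1 (g - 1%:M) -> vanish k A -> vanish k.+1 (A *m g - A).
Proof.
move=> vg vA; rewrite -{2}(mulmx1 A) -mulmxBr -addn1; exact: vanishM.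
Qed.

End Vanishing.

(** * The exponential to first order *)

Section Exponential.
Variables (K : fieldType) (p : nat).

Lemma mxexp_partial (a : nat) (X : 'M[fps p K]_a) d : vanish 1 X ->
  exists N0, forall N, (N0 <= N)%N ->
    vanish d (\sum_(k < N) fpsC p (k`!%:R^-1) *: X ^+ k - mxexp X).
Proof.
move=> /jet_vanish0 /mxexp_cvg /(_ d) [N0 HN]; exists N0 => N /HN /jet_vanish.
exact: vanish_le.
Qed.

(** Each of the terms [X ^ i E Y ^ (k - i)], which sum up to
    [X ^ (k + 1) A - A Y ^ (k + 1)], has [k] factors without constant term. *)
Lemma intertwineX (a b : nat) (X : 'M[fps p K]_a) (Y : 'M[fps p K]_b)
    (A : 'M[fps p K]_(a, b)) j k :
    vanish 1 X -> vanish 1 Y -> vanish j (X *m A - A *m Y) ->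
  vanish (j + k) (X ^+ k.+1 *m A - A *m Y ^+ k.+1).
Proof.
move=> vX vY vE; elim: k => [|k IHk]; first by rewrite addn0 !expr1.
have -> : X ^+ k.+2 *m A - A *m Y ^+ k.+2 =
    X *m (X ^+ k.+1 *m A - A *m Y ^+ k.+1) + (X *m A - A *m Y) *m Y ^+ k.+1.
  by rewrite (exprS X) (exprS Y) -!mulmxE mulmxBr mulmxBl !mulmxA subrKA.
apply: vanishD; first by rewrite addnS -add1n; apply: vanishM.
apply: vanishM vE _ => i l I Ik.
by apply: mxX_small Ik; apply/jet_vanish0.
Qed.

(** In the difference of the two exponential series the constant terms cancel,
    the linear terms give [X A - A Y], and [intertwineX] puts all the others
    in degree above [j].  Taking two different matrices [X] and [Y] makes the
    lemma serve the action on rectangular matrices as well as, for [A = 1],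
    the variation of the exponential itself. *)
Lemma mxexp_intertwine (a b : nat) (X : 'M[fps p K]_a) (Y : 'M[fps p K]_b)
    (A : 'M[fps p K]_(a, b)) j :
    vanish 1 X -> vanish 1 Y -> vanish j (X *m A - A *m Y) ->
  vanish j.+1 (mxexp X *m A - (A *m mxexp Y + (X *m A - A *m Y))).
Proof.
move=> vX vY vE; set E := _ - _ in vE *.
have [N1 H1] := mxexp_partial j.+1 vX; have [N2 H2] := mxexp_partial j.+1 vY.
pose N := (maxn N1 N2).
have {}H1 := H1 N.+2 (leq_trans (leq_maxl _ _) (leqW (leqnSn _))).
have {}H2 := H2 N.+2 (leq_trans (leq_maxr _ _) (leqW (leqnSn _))).
move: H1 H2; set eX := \sum_(k < _) _; set eY := \sum_(k < _) _ => H1 H2.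
apply: (@vanish_trans _ _ _ _ _ _ (eX *m A)).
  by rewrite -mulmxBl; apply/vanishMr/vanish_sym.
apply: (@vanish_trans _ _ _ _ _ _ (A *m eY + E)); last first.
  by rewrite opprD addrACA subrr addr0 -mulmxBr; apply/vanishMl.
rewrite opprD addrA mulmx_suml mulmx_sumr -sumrB.
rewrite 2!big_ord_recl /= !expr0 !expr1 factS fact0 invr1 !scale1r.
(* The terms of index 0 and 1 of the two series account exactly for E. *)
have -> : forall M : 'M[fps p K]_(a, b),
    1 *m A - A *m 1 + (X *m A - A *m Y + M) - E = M.
  by move=> M; rewrite mul1mx mulmx1 subrr add0r addrC addKr.
apply: vanish_sum => k _; rewrite -scalemxAl -scalemxAr -scalerBr.
rewrite /bump /= !add1n.
apply: vanishZ; have := @intertwineX _ _ X Y A j k.+1 vX vY vE; rewrite addnS.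
apply: vanish_le; rewrite ltnS; exact: leq_addr.
Qed.

(** If [X A - A Y] had a nonzero part of degree [d < j], then by
    [mxexp_intertwine] the same part would appear in [exp X A - A exp Y]. *)
Lemma vanish_mxexp (a b : nat) (X : 'M[fps p K]_a) (Y : 'M[fps p K]_b)
    (A : 'M[fps p K]_(a, b)) j :
    vanish 1 X -> vanish 1 Y -> vanish j (mxexp X *m A - A *m mxexp Y) ->
  vanish j (X *m A - A *m Y).
Proof.
move=> vX vY vexp.
suff H d : (d <= j)%N -> vanish d (X *m A - A *m Y) by apply: H.
elim: d => [//|d IHd] dj.
have H := vanish_addl (mxexp_intertwine vX vY (IHd (ltnW dj))).
exact: vanish_congr (vanish_sym H) (vanish_le dj vexp).
Qed.

Lemma mxexp0 (a : nat) : mxexp (0 : 'M[fps p K]_a) = 1%:M.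
Proof.
apply/matrixP => i j; apply: fpsP => I; rewrite mxE /= big_ord_recl expr0.
rewrite fact0 invr1 scale1r big1 ?addr0 // => k _.
by rewrite exprS mul0r scaler0.
Qed.

Lemma mxexp_shift (a : nat) (X Y : 'M[fps p K]_a) k :
    vanish 1 X -> vanish 1 Y -> vanish k (X - Y) ->
  vanish k.+1 (mxexp X - (mxexp Y + (X - Y))).
Proof.
move=> vX vY; have := @mxexp_intertwine _ _ X Y 1%:M k vX vY.
by rewrite !mulmx1 !mul1mx.
Qed.

Lemma mxexp_lead (a : nat) (X : 'M[fps p K]_a) k :
  vanish 1 X -> vanish k X -> vanish k.+1 (mxexp X - (1%:M + X)).
Proof.
move=> vX vkX; have := @mxexp_shift _ X 0 k vX (@vanish00 _ _ _ _ _).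
by rewrite mxexp0 subr0; apply.
Qed.

Lemma mxexp_unipotent (a : nat) (X : 'M[fps p K]_a) :
  vanish 1 X -> vanish 1 (mxexp X - 1%:M).
Proof.
move=> vX; have := vanish_le (ltnW (ltnSn 1)) (mxexp_lead vX vX).
by move=> /vanish_addl /vanish_congr; apply.
Qed.

Lemma vanish_mxexp1 (a : nat) (X : 'M[fps p K]_a) k :
  vanish 1 X -> vanish k (mxexp X - 1%:M) -> vanish k X.
Proof.
move=> vX; have := @vanish_mxexp _ _ X 0 1%:M k vX (@vanish00 _ _ _ _ _).
by rewrite mxexp0 !mulmx1 mulmx0 subr0; apply.
Qed.

(** The logarithm by successive approximation: adding the error
    [g - exp X] to [X] corrects [exp X] to one more degree, by [mxexp_shift]. *)
Lemma mxexp_surj (a : nat) (g : 'M[fps p K]_a) : vanish 1 (g - 1%:M) ->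
  exists2 X, vanish 1 X & mxexp X = g.
Proof.
move=> vg; have [u [u0 uS]] : exists u : nat -> 'M[fps p K]_a,
    u 0%N = 0 /\ forall k, u k.+1 = u k + (g - mxexp (u k)).
  by exists (fun k => iter k (fun X => X + (g - mxexp X)) 0).
have duS k : u k.+1 - u k = g - mxexp (u k) by rewrite uS addrC addKr.
have uP k : vanish 1 (u k) /\ vanish k.+1 (g - mxexp (u k)).
  elim: k => [|k [vu vk]]; first by
    rewrite u0 mxexp0; split=> //; apply: vanish00.
  have vu' : vanish 1 (u k.+1).
    by rewrite uS; apply: vanishD => //; apply: vanish_le vk.
  split; first exact: vu'.
  apply: vanish_sym; have := @mxexp_shift _ (u k.+1) (u k) k.+1 vu' vu.
  by rewrite duS [_ + (g - _)]addrC subrK; apply.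
have [k|X XP] := @limit_exists _ _ _ _ u.
  by rewrite duS; apply: vanish_le (uP k).2.
have vX : vanish 1 X by apply: vanish_congr (vanish_sym (XP 1%N)) (uP 1%N).1.
exists X => //; apply/eqP; rewrite -subr_eq0; apply/eqP/vanish_eq0 => k.
have vk := vanish_sym (XP k).
apply: (@vanish_trans _ _ _ _ _ _ (mxexp (u k))); last first.
  by apply/vanish_sym; apply: vanish_le (uP k).2.
have := vanish_le (leqnSn k) (mxexp_shift vX (uP k).1 vk).
by move=> /vanish_addl /vanish_congr; apply.
Qed.

End Exponential.

(** * Compactness of affine subspaces *)

(** Linear compactness of a finite product of lines, in coordinates.  The
    elements of [C j] stand for points of the space of functions on [s], and
    the last hypothesis says that these points form an affine subspace.  The
    values of one coordinate on [C j] form a single point or the whole line, so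
    there is a value taken on every [C j]: the constant value if the coordinate
    is constant on some [C j], any value otherwise.  Imposing it leaves affine
    subspaces again, and one proceeds to the next coordinate. *)
Lemma affine_compactness (K : fieldType) (X : Type) (T : eqType)
    (ev : T -> X -> K) (s : seq T) (C : nat -> set X) :
    (forall j, exists x, C j x) ->
    (forall i j, (i <= j)%N -> C j `<=` C i) ->
    (forall j x y z (t : K), C j x -> C j y -> C j z ->
       exists2 w, C j w & forall a, ev a w = ev a x + t * (ev a y - ev a z)) ->
  exists c : T -> K, forall j,
    exists2 x, C j x & forall a, a \in s -> ev a x = c a.
Proof.
elim: s C => [|a s IHs] C C0 Cle Caff.
  by exists (fun=> 0) => j; have [x] := C0 j; exists x.
have [v Hv] : exists v, forall j, exists2 x, C j x & ev a x = v.
  have [[j Hj]|Hn] :=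
    EM (exists j, forall y z, C j y -> C j z -> ev a y = ev a z).
    have [y Cy] := C0 j; exists (ev a y) => i.
    have [x Cx] := C0 (maxn i j); exists x.
      by apply: Cle Cx; apply: leq_maxl.
    by apply: Hj => //; apply: Cle Cx; apply: leq_maxr.
  exists 0 => j; have [x Cx] := C0 j.
  have [y [z [Cy Cz yz]]] : exists y z,
      [/\ C j y, C j z & ev a y - ev a z != 0].
    apply: contrapT => H; apply: Hn; exists j => y z Cy Cz.
    apply/eqP; rewrite -subr_eq0; apply/negPn/negP => yz.
    by apply: H; exists y, z.
  have [w Cw wE] := Caff j x y z (- ev a x / (ev a y - ev a z)) Cx Cy Cz.
  by exists w; rewrite ?wE ?divfK ?subrr.
have [j|i j ij x [Cx xv]|j x y z t [Cx xv] [Cy yv] [Cz zv]|c Hc] :=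
    IHs (fun j => [set x | C j x /\ ev a x = v]).
- by have [x Cx xv] := Hv j; exists x.
- by split=> //; apply: Cle Cx.
- have [w Cw wE] := Caff j x y z t Cx Cy Cz; exists w => //; split=> //.
  by rewrite wE xv yv zv subrr mulr0 addr0.
exists (fun b => if b == a then v else c b) => j.
have [x [Cx xv] xc] := Hc j; exists x => // b; rewrite inE.
by case: eqP => [-> //|_] /= bs; apply: xc.
Qed.

(** * The group G^0 and its orbits *)

Section UnipotentGroup.
Variables (K : fieldType) (m n p : nat).
Local Notation Mat := 'M[fps p K]_(m, n).
Local Notation pair := ('M[fps p K]_m * 'M[fps p K]_n)%type.
Implicit Types (g h x y z w l : pair) (A B : Mat) (G : set pair).

Definition pvanish d (g : pair) : Prop := vanish d g.1 /\ vanish d g.2.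

Lemma pair_jet_vanish d g h : pair_jet d g = pair_jet d h <-> pvanish d (g - h).
Proof.
rewrite /pair_jet /pvanish; split=> [[/jet_vanish ? /jet_vanish ?]|].
  by split.
by move=> [/jet_vanish /= -> /jet_vanish /= ->].
Qed.

Lemma pair_jet1_vanish l : pair_jet 1 l = (0, 0) <-> pvanish 1 l.
Proof.
rewrite /pair_jet /pvanish; split=> [[/jet_vanish0 ? /jet_vanish0 ?]|].
  by split.
by move=> [/jet_vanish0 /= -> /jet_vanish0 /= ->].
Qed.

Lemma jet1_1 (a : nat) : jet 1 (1%:M : 'M[fps p K]_a) = 1%:M.
Proof.
apply/matrixP => i j; apply: fpsP => I; rewrite jetE ltnS leqn0 mdeg_eq0 mxE.
case: eqP => // /eqP I0; case: (i == j); last by rewrite fps0E.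
by rewrite /= (negPf I0).
Qed.

Lemma unipotent_partE G g :
  unipotent_part G g <-> G g /\ pvanish 1 (g - pair_one K m n p).
Proof.
have e1 : pair_jet 1 (pair_one K m n p) = pair_one K m n p.
  by rewrite /pair_jet /pair_one /= !jet1_1.
by rewrite /unipotent_part /= -pair_jet_vanish e1.
Qed.

(** Clearing the denominator turns the action into a bilinear condition, which
    passes to jets without any inverse. *)
Lemma actE g A B : g.2 \in unitmx -> act g A = B <-> g.1 *m A = B *m g.2.
Proof.
move=> u; rewrite /act; split=> [<-|->]; last by rewrite mulmxK.
by rewrite mulmxKV.
Qed.

Variable G : set pair.
Hypothesis HG : is_Lie_group G.

Let G0 := unipotent_part G.

Lemma unipotent_part_mul g h : G0 g -> G0 h -> G0 (pair_mul g h).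
Proof.
have [[_ _ GM _] _ _] := HG.
move=> /unipotent_partE [Gg [g1 g2]] /unipotent_partE [Gh [h1 h2]].
apply/unipotent_partE; split; first exact: GM.
split; rewrite /= ?mulmx1.
  by apply: vanish_trans g1; rewrite -{2}(mulmx1 g.1) -mulmxBr; apply: vanishMl.
by apply: vanish_trans g2; rewrite -{2}(mulmx1 g.2) -mulmxBr; apply: vanishMl.
Qed.

Lemma pair_unit g : G g -> g.1 \in unitmx /\ g.2 \in unitmx.
Proof. by have [[GL _ _ _] _ _] := HG; apply: GL. Qed.

Lemma vanish_invmx (a : nat) (u : 'M[fps p K]_a) k : u \in unitmx ->
  vanish k (u - 1%:M) -> vanish k (invmx u - 1%:M).
Proof.
move=> uU vu; rewrite -(mulVmx uU) -{1}(mulmx1 (invmx u)) -mulmxBr.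
by apply/vanishMl/vanish_sym.
Qed.

Lemma unipotent_part_inv g : G0 g -> G0 (pair_inv g).
Proof.
have [[_ _ _ GV] _ _] := HG.
move=> /unipotent_partE [Gg [g1 g2]]; have [u1 u2] := pair_unit Gg.
apply/unipotent_partE; split; first exact: GV.
by split; apply: vanish_invmx.
Qed.

Lemma pair_exp_surj g : G0 g ->
  exists l, [/\ pvanish 1 l, pair_exp l = g &
    forall t, G (pair_exp (pair_scale t l))].
Proof.
have [_ _ GL] := HG.
move=> /[dup] gG0 /unipotent_partE [Gg].
move=> [/mxexp_surj [l1 v1 e1] /mxexp_surj [l2 v2 e2]].
have e : pair_exp (l1, l2) = g by rewrite /pair_exp /= e1 e2; case: (g).
exists (l1, l2); split=> // t; apply: GL; last by rewrite e.
exact/pair_jet1_vanish.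
Qed.

Lemma pair_exp_unipotent l : pvanish 1 l -> G (pair_exp l) -> G0 (pair_exp l).
Proof.
move=> [v1 v2] Gl; apply/unipotent_partE; split=> //.
by split; apply: mxexp_unipotent.
Qed.

Lemma pvanish_scale t d l : pvanish d l -> pvanish d (pair_scale t l).
Proof. by move=> [v1 v2]; split; apply: vanishZ. Qed.

Lemma inf_act_scale t l A :
  inf_act (pair_scale t l) A = fpsC p t *: inf_act l A.
Proof. by rewrite /inf_act /= scalerBr scalemxAl scalemxAr. Qed.

(** Elements that carry [A] to [B] below degree [j].  As in [actE] the inverse
    of [g.2] is avoided: multiplying by [g.2] does not affect vanishing below
    degree [j]. *)
Definition transporter j A B : set pair :=
  [set g | G0 g /\ vanish j (g.1 *m A - B *m g.2)].

(** Write [y = z h] with [h = exp l].  As [y] and [z] both carry [A] to [B], [h]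
    fixes [A], hence [l] annihilates [A] and [exp (t l)] fixes [A]; the witness
    is [w = x exp (t l)].  Since [x] and [z] are unipotent, the terms of degree
    [k] of [y - z] and of [w - x] are those of [l] and of [t l]. *)
Lemma transporter_affine j k A B x y z t : (0 < k)%N ->
    transporter j A B x -> transporter j A B y -> transporter j A B z ->
    pvanish k (y - z) ->
  exists2 w, transporter j A B w &
    pvanish k.+1 (w - (x + pair_scale t (y - z))).
Proof.
move=> k0 [G0x Tx] [G0y Ty] [G0z Tz] [vyz1 vyz2].
have [Gz [uz1 uz2]] := (unipotent_partE _ _).1 G0z.
have [U1 U2] := pair_unit Gz.
have [h [G0h zh1 zh2]] : exists h,
    [/\ G0 h, z.1 *m h.1 = y.1 & z.2 *m h.2 = y.2].
  exists (pair_mul (pair_inv z) y); rewrite /= !mulKVmx //; split=> //.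
  by apply: unipotent_part_mul => //; apply: unipotent_part_inv.
have [l [[vl1 vl2] el GL]] := pair_exp_surj G0h.
have [e1 e2] : mxexp l.1 = h.1 /\ mxexp l.2 = h.2 by rewrite -el.
have vA : vanish j (inf_act l A).
  apply: vanish_mxexp => //.
  rewrite e1 e2; suff H : vanish j (z.1 *m (h.1 *m A - A *m h.2)).
    by rewrite -(mulKmx U1 (_ - _)); apply: vanishMl.
  rewrite mulmxBr !mulmxA zh1; apply: (vanish_trans Ty).
  rewrite -zh2 mulmxA -mulmxBl; exact/vanishMr/vanish_sym.
(* The leading terms of y - z and of l agree, in either component. *)
have vhk (a : nat) (u y' l' : 'M[fps p K]_a) : u \in unitmx ->
    vanish 1 (u - 1%:M) -> vanish k (y' - u) -> vanish 1 l' ->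
    u *m mxexp l' = y' ->
    vanish k l' /\ vanish k.+1 (y' - u - l').
  move=> U vu vy vl e.
  have ve : vanish k (mxexp l' - 1%:M).
    rewrite -(mulKmx U (_ - _)) mulmxBr mulmx1 e; exact: vanishMl.
  have vk := vanish_mxexp1 vl ve; split=> //.
  have -> : y' - u = u *m (mxexp l' - 1%:M) by rewrite mulmxBr mulmx1 e.
  apply: (vanish_trans (unipotent_mull vu ve)).
  by have := mxexp_lead vl vk; rewrite opprD addrA.
rewrite -e1 in zh1; rewrite -e2 in zh2.
have [vk1 d1] := vhk _ _ _ _ U1 uz1 vyz1 vl1 zh1.
have [vk2 d2] := vhk _ _ _ _ U2 uz2 vyz2 vl2 zh2.
pose e := pair_exp (pair_scale t l).
have G0e : G0 e by apply: pair_exp_unipotent => //; apply: pvanish_scale.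
exists (pair_mul x e).
  split; first exact: unipotent_part_mul.
  apply: (@vanish_trans _ _ _ _ _ _ (x.1 *m A *m e.2)); last first.
    by rewrite /= mulmxA -mulmxBl; apply: vanishMr.
  rewrite /= -!mulmxA -mulmxBr; apply: vanishMl.
  have vt : vanish j (inf_act (pair_scale t l) A).
    by rewrite inf_act_scale; apply: vanishZ.
  have [v1 v2] : pvanish 1 (pair_scale t l) by apply: pvanish_scale.
  have := vanish_le (leqnSn j) (mxexp_intertwine v1 v2 vt).
  by move=> /vanish_addl /vanish_congr; apply.
(* The leading terms of x exp (t l) - x and of t (y - z) agree as well. *)
have lead (a : nat) (x' l' d' : 'M[fps p K]_a) : vanish 1 (x' - 1%:M) ->
    vanish 1 l' -> vanish k l' -> vanish k.+1 (d' - l') ->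
    vanish k.+1 (x' *m mxexp (fpsC p t *: l') - (x' + fpsC p t *: d')).
  move=> vx v1 vk vd; set L := fpsC p t *: l'.
  have vL1 : vanish 1 L := vanishZ t v1.
  have vLk : vanish k L := vanishZ t vk.
  apply: (@vanish_trans _ _ _ _ _ _ (x' *m (1%:M + L))).
    by rewrite -mulmxBr; apply/vanishMl/mxexp_lead.
  rewrite mulmxDr mulmx1 opprD addrACA subrr add0r.
  apply: (vanish_trans (unipotent_mull vx vLk)); rewrite -scalerBr.
  exact/vanishZ/vanish_sym.
have [_ [vx1 vx2]] := (unipotent_partE _ _).1 G0x.
by split; apply: lead.
Qed.

Lemma transporter_le i j A B :
  (i <= j)%N -> transporter j A B `<=` transporter i A B.
Proof. by move=> ij g [G0g Tg]; split=> //; apply: vanish_le Tg. Qed.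

(** [affine_compactness] for the finitely many coefficients of degree at most
    [k]: those of degree [k] are the unknowns, and the lower ones are constant
    on the sets considered. *)
Lemma transporter_step k A B g : (0 < k)%N ->
    (forall j, exists2 x, transporter j A B x & pvanish k (x - g)) ->
  exists2 h, pvanish k (h - g) &
    forall j, exists2 x, transporter j A B x & pvanish k.+1 (x - h).
Proof.
move=> k0 Hg.
pose T : finType :=
  ('I_m * 'I_m * 'X_{1..p < k.+1} + 'I_n * 'I_n * 'X_{1..p < k.+1})%type.
pose ev (a : T) (x : pair) : K := match a with
  | inl (i, j, J) => x.1 i j J | inr (i, j, J) => x.2 i j J end.
pose C j := [set x | transporter j A B x /\ pvanish k (x - g)].
have psub x y z : pvanish k (x - y) -> pvanish k (z - y) -> pvanish k (x - z).
  move=> [x1 x2] [z1 z2].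
  by split; [apply: (vanish_trans x1) | apply: (vanish_trans x2)];
    apply: vanish_sym.
have ev_congr a x y : pvanish k.+1 (x - y) -> ev a x = ev a y.
  move=> [v1 v2]; apply/eqP; rewrite -subr_eq0; apply/eqP.
  case: a => [] [[i j] I] /=.
    by have := v1 i j I (bmdeg I); rewrite !mxE.
  by have := v2 i j I (bmdeg I); rewrite !mxE.
have [j|i j ij x [Tx vx]|j x y z t [Tx vx] [Ty vy] [Tz vz]|c Hc] :=
    @affine_compactness K pair T ev (enum {: T}) C.
- by have [x] := Hg j; exists x.
- by split=> //; apply: transporter_le Tx.
- have vyz : pvanish k (y - z) by apply: psub vy vz.
  have [w Tw vw] := transporter_affine t k0 Tx Ty Tz vyz; exists w.
    split=> //.
    have [[[w1 w2] [x1 x2]] [s1 s2]] := (vw, vx, pvanish_scale t vyz).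
    split; [apply: vanish_trans x1 | apply: vanish_trans x2].
      by apply: vanish_congr s1; rewrite -addrA -opprD; apply: vanish_le w1.
    by apply: vanish_congr s2; rewrite -addrA -opprD; apply: vanish_le w2.
  move=> a; rewrite (ev_congr a _ _ vw).
  by case: a => [] [[i i'] I] /=; rewrite !mxE /= fpsCM ?mxE.
have [x0 [_ v0] c0] := Hc 0%N; exists x0 => // j.
have [x [Tx vx] cx] := Hc j; exists x => //.
have ex a : ev a x = ev a x0 by rewrite cx ?c0 ?mem_enum.
split=> i i' I Ik; rewrite !mxE /=; apply/eqP; rewrite subr_eq0; apply/eqP.
  exact: (ex (inl (i, i', BMultinom Ik))).
exact: (ex (inr (i, i', BMultinom Ik))).
Qed.

(** The jets chosen by [transporter_step] are the jets of a single pair, a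
    limit of elements of [G^0] that carry [A] closer and closer to [B]. *)
Lemma orbit_closed A B :
  (forall j, exists x, transporter j A B x) -> exists2 g, G0 g & act g A = B.
Proof.
(* The index is shifted by one: [transporter_step] needs a positive degree, and
   the constant terms of a unipotent pair are known. *)
move=> T0; pose P k g := forall j,
  exists2 x, transporter j A B x & pvanish k.+1 (x - g).
have P0 : P 0%N (pair_one K m n p).
  move=> j; have [x Tx] := T0 j; exists x => //.
  by have [/unipotent_partE []] := Tx.
pose R (u v : {kg : nat * pair | P kg.1 kg.2}) :=
  (sval v).1 = (sval u).1.+1 /\ pvanish (sval u).1.+1 ((sval v).2 - (sval u).2).
have step u : {v | R u v}.
  apply: cid; case: u => [[k g] /= Pg].
  have [h hg Ph] := @transporter_step k.+1 A B g isT Pg.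
  by exists (exist _ (k.+1, h) Ph).
have [f [f0 fR]] := dependent_choice step (exist _ (0%N, _) P0).
have fk k : (sval (f k)).1 = k.
  by elim: k => [|k IHk]; rewrite ?f0 //; have [-> _] := fR k; rewrite IHk.
have [k|g1 v1] := @limit_exists K p _ _ (fun k => (sval (f k)).2.1).
  by have [_ [+ _]] := fR k; rewrite fk; apply: vanish_le.
have [k|g2 v2] := @limit_exists K p _ _ (fun k => (sval (f k)).2.2).
  by have [_ [_ +]] := fR k; rewrite fk; apply: vanish_le.
have Hg j : exists x, transporter j A B x /\ pvanish j (x - (g1, g2)).
  have [x Tx] := svalP (f j) j; rewrite fk => -[x1 x2]; exists x; split=> //.
  by split; [apply: vanish_trans (v1 j) | apply: vanish_trans (v2 j)];
    apply: vanish_le (leqnSn j) _.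
have [u uP] := choice Hg.
have Gg : G (g1, g2).
  have [_ Gcl _] := HG; apply: (Gcl u).
    by move=> k; have [[/unipotent_partE []]] := uP k.
  move=> j; exists j.+1 => k jk; apply/pair_jet_vanish.
  by have [_ [w1 w2]] := uP k; split; apply: vanish_le jk _.
have G0g : G0 (g1, g2).
  apply/unipotent_partE; split=> //.
  have [[/unipotent_partE [_ [w1 w2]] _] [z1 z2]] := uP 1%N.
  by split; [apply: vanish_trans w1 | apply: vanish_trans w2];
    apply: vanish_sym.
exists (g1, g2) => //; apply/actE; first exact: (pair_unit Gg).2.
apply/eqP; rewrite -subr_eq0; apply/eqP/vanish_eq0 => j /=.
have [[_ Tu] [z1 z2]] := uP j.
apply: (@vanish_trans _ _ _ _ _ _ ((u j).1 *m A)).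
  by rewrite -mulmxBl; apply/vanishMr/vanish_sym.
by apply: (vanish_trans Tu); rewrite -mulmxBr; apply: vanishMl.
Qed.

(** The factor [exp l.2] on the right of [mxexp_intertwine] may be divided out:
    being unipotent, it does not change the terms of degree [j] of
    [inf_act l B]. *)
Lemma act_exp_linear l B j : pvanish 1 l -> G (pair_exp l) ->
    vanish j (inf_act l B) ->
  vanish j.+1 (act (pair_exp l) B - (B + inf_act l B)).
Proof.
move=> vl Ge vE; have [U1 U2] := pair_unit Ge; have [v1 v2] := vl.
set E := inf_act l B in vE *.
have -> : act (pair_exp l) B - (B + E) =
    (mxexp l.1 *m B - (B + E) *m mxexp l.2) *m invmx (mxexp l.2).
  by rewrite mulmxBl mulmxK.
apply: vanishMr; rewrite mulmxDl.
apply: (vanish_trans (mxexp_intertwine v1 v2 vE)).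
rewrite opprD addrACA subrr add0r; apply/vanish_sym.
by apply: unipotent_mulr vE; apply: mxexp_unipotent.
Qed.

Lemma hpart_vanish j A B : vanish j.+1 (A - B) -> hpart j A = hpart j B.
Proof.
move=> v; apply/matrixP => i k; apply: fpsP => I; rewrite !hpartE.
case: eqP => // e; apply/eqP; rewrite -subr_eq0 -(v i k I) ?e //.
by rewrite !mxE.
Qed.

Lemma hpartB j A B : hpart j (A - B) = hpart j A - hpart j B.
Proof.
apply/matrixP => i k; apply: fpsP => I; rewrite !mxE /= !hpartE !mxE /=.
by case: eqP => // _; rewrite subr0.
Qed.

Lemma hpart_jet j A : vanish j A -> hpart j A = jet j.+1 A.
Proof.
move=> v; apply/matrixP => i k; apply: fpsP => I.
rewrite hpartE jetE ltnS leq_eqVlt.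
by case: eqP => //= _; case: ifP => // /v.
Qed.

(** * Normal forms *)

Variable W : nat -> Mat -> set Mat.
Hypothesis hW : forall j A,
  is_complement (homogeneous p K j m n) (tangent G j A) (W j A).
Hypothesis hWjet : forall j A, W j A = W j (jet j A).

Lemma W_vanish j A B : vanish j (A - B) -> W j A = W j B.
Proof. by move=> /jet_vanish e; rewrite hWjet e -hWjet. Qed.

(** The correction is [exp (- nu)], where [nu B] is the tangent component of the
    part of degree [j] of [B]; only in degrees from [j] on does it act. *)
Lemma normalize_step j B : exists g, [/\ G0 g,
  vanish j (act g B - B) & W j (act g B) (hpart j (act g B))].
Proof.
have [_ sumW _] := hW j B.
have : homogeneous p K j m n (hpart j B).
  by move=> i k I /negPf Ij; rewrite hpartE Ij.
rewrite -sumW => -[_ [nu [[vnu GL] /jet_vanish0 vE] <-] [w Ww e]].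
move: vnu => /pair_jet1_vanish vnu.
pose l := pair_scale (-1) nu.
have vl : pvanish 1 l by apply: pvanish_scale.
have lE : inf_act l B = - inf_act nu B.
  by rewrite inf_act_scale fpsCN1 scaleN1r.
have vlE : vanish j (inf_act l B) by rewrite lE; apply: vanishN.
have v := act_exp_linear vl (GL _) vlE.
have vB : vanish j (act (pair_exp l) B - B).
  by have := vanish_le (leqnSn j) v; move=> /vanish_addl /vanish_congr; apply.
exists (pair_exp l); split=> //; first exact: (pair_exp_unipotent vl (GL _)).
rewrite (W_vanish vB) (hpart_vanish v) lE hpartB (hpart_jet vE) -e.
by rewrite addrC addKr.
Qed.

Lemma act_mul g h A : G g -> G h -> act (pair_mul g h) A = act g (act h A).
Proof.
move=> Gg Gh; have [[_ g2] [_ h2]] := (pair_unit Gg, pair_unit Gh).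
apply/actE; first by rewrite unitmx_mul g2.
by rewrite /act /= !mulmxA mulmxKV // mulmxKV.
Qed.

(** The sequence of corrected matrices converges, and its limit lies in the
    orbit because the orbit is closed. *)
Lemma normal_form_exists A : exists2 g, G0 g & normal_set W (act g A).
Proof.
have [f fP] := choice (fun jB : nat * Mat => normalize_step jB.1 jB.2).
pose u := fix u j := if j is i.+1 then act (f (i, u i)) (u i) else A.
have [k|B vB] := @limit_exists K p _ _ u.
  by have [_ + _] := fP (k, u k).
have u_orbit j : exists2 g, G0 g & act g A = u j.
  elim: j => [|j [g [Gg gu] e]].
    have [[_ G1 _ _] _ _] := HG.
    exists (pair_one K m n p).
      apply/unipotent_partE; split=> //.
      by split; rewrite subrr; apply: vanish00.
    by rewrite /act /= mul1mx invmx1 mulmx1.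
  have [[Gf fu] _ _] := fP (j, u j).
  exists (pair_mul (f (j, u j)) g); first exact: unipotent_part_mul.
  by rewrite act_mul // e.
have [j|g Gg gB] := @orbit_closed A B.
  have [g [Gg gu] e] := u_orbit j; exists g; split=> //.
  rewrite ((actE _ _ (pair_unit Gg).2).1 e) -mulmxBl.
  exact: vanishMr.
exists g => //; rewrite gB => j.
have [_ _ /=] := fP (j, u j); rewrite -/(u j.+1).
have v := vB j.+1.
by rewrite (hpart_vanish v) (W_vanish (vanish_le (leqnSn j) v)).
Qed.

(** If [B] and [g B] agree below degree [j], then their difference in degree
    [j] is both a tangent vector and an element of [W j B]. *)
Lemma normal_form_unique B g :
  G0 g -> normal_set W B -> normal_set W (act g B) -> act g B = B.
Proof.
move=> G0g NB NgB; apply/eqP; rewrite -subr_eq0; apply/eqP/vanish_eq0.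
have [l [vl el GL]] := pair_exp_surj G0g; have [v1 v2] := vl.
have Gg : G g by case: G0g.
elim=> [//|j IHj].
have vE : vanish j (inf_act l B).
  apply: vanish_mxexp => //.
  have [-> ->] : mxexp l.1 = g.1 /\ mxexp l.2 = g.2 by rewrite -el.
  have -> : g.1 *m B = act g B *m g.2.
    by apply/actE => //; apply: (pair_unit Gg).2.
  by rewrite -mulmxBl; apply: vanishMr.
have Ge : G (pair_exp l) by rewrite el.
have v := act_exp_linear vl Ge vE; rewrite el in v.
suff E0 : jet j.+1 (inf_act l B) = 0.
  apply: vanish_congr _ ((jet_vanish0 _ _).1 E0).
  by rewrite -addrA -opprD.
have [[_ WD WZ] _ VW] := hW j B.
suff : [set 0] (jet j.+1 (inf_act l B)) by [].
rewrite -VW; split.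
  exists l => //; split; last exact/jet_vanish0.
  by split; first exact/pair_jet1_vanish.
have -> : jet j.+1 (inf_act l B) =
    hpart j (act g B) + fpsC p (-1) *: hpart j B.
  by rewrite fpsCN1 scaleN1r -hpartB (hpart_vanish (vanish_addl v)) hpart_jet.
by apply: WD; [rewrite -(W_vanish IHj); apply: NgB | apply: WZ; apply: NB].
Qed.

End UnipotentGroup.

Theorem theorem5p1 (K : fieldType) (m n p : nat)
    (G : set ('M[fps p K]_m * 'M[fps p K]_n))
    (W : nat -> 'M[fps p K]_(m, n) -> set 'M[fps p K]_(m, n))
    (hK : [pchar K]%R =i pred0)
    (hm : (1 <= m)%N) (hn : (1 <= n)%N) (hp : (1 <= p)%N)
    (hG : is_Lie_group G)
    (hW : forall (j : nat) (A : 'M[fps p K]_(m, n)),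
        is_complement (homogeneous p K j m n) (tangent G j A) (W j A))
    (hWjet : forall (j : nat) (A : 'M[fps p K]_(m, n)),
        W j A = W j (jet j A)) :
  is_normal_form G (normal_set W) /\
  is_canonical_form (unipotent_part G) (normal_set W).
Proof.
have NF A : exists2 g, unipotent_part G g & normal_set W (act g A).
  exact: normal_form_exists.
split=> A; have [g G0g Ng] := NF A; exists (act g A).
  by split=> //; exists g => //; case: G0g.
split=> [|_ [[h G0h <-] Nh]]; first by split=> //; exists g.
have G0V : unipotent_part G (pair_inv g) by apply: unipotent_part_inv.
have hg : act h A = act (pair_mul h (pair_inv g)) (act g A).
  have [[[Gg _] [GV _]] [Gh _]] := (G0g, G0V, G0h).
  have [u1 u2] := pair_unit hG Gg.
  rewrite (act_mul hG) //; congr act.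
  by rewrite /act /= invmxK !mulmxA mulVmx // mul1mx mulmxKV.
rewrite hg in Nh *; apply/esym; apply: (normal_form_unique hG hW hWjet) => //.
exact: unipotent_part_mul.
Qed.
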